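(* Assume the matrix $\boldsymbol B_1(\theta)$ satisfies $$\frac1{|\vec v|}\left(\boldsymbol B_1(\theta)\vec w\right)\cdot(\vec w-\vec v)\ \ge\ |\vec w|\,\gamma(\hat\theta)-|\vec v|\,\gamma(\theta)$$ for all nonzero vectors $\vec v=|\vec v|(\cos\theta,\sin\theta)^\top$ and $\vec w=|\vec w|(\cos\hat\theta,\sin\hat\theta)^\top$ in $\mathbb R^2$, $\theta,\hat\theta\in[-\pi,\pi]$. Let $\eta>0$, $\sigma\in\mathbb R$, $\Delta t_m>0$, let $\vec X^m=(r^m,z^m)^\top\in\mathbb X^h$, and let $(\vec X^{m+1},\mu^{m+1})\in\mathbb X^h\times\mathbb K^h$ with $\vec X^{m+1}=(r^{m+1},z^{m+1})^\top$ be a solution of the scheme $$\frac1{\Delta t_m}\left\langle\vec X^{m+1}-\vec X^m,\ \varphi^h\vec f^{\,m+\frac12}\right\rangle-\left\langle r^m\partial_\rho\mu^{m+1},\ \partial_\rho\varphi^h\,|\partial_\rho\vec X^m|^{-1}\right\rangle=0\qquad\forall\varphi^h\in\mathbb K^h,$$ $$\begin{aligned}&\left\langle\mu^{m+1}\vec f^{\,m+\frac12},\ \vec\psi^h\right\rangle+\left\langle\gamma(\theta^{m+1}),\ \psi_1^h|\partial_\rho\vec X^{m+1}|\right\rangle+\left\langle r^m\boldsymbol B_1(\theta^m)\partial_\rho\vec X^{m+1},\ \partial_\rho\vec\psi^h\,|\partial_\rho\vec X^m|^{-1}\right\rangle\\&+\frac1{2\eta\Delta t_m}\left[(r_L^{m+1}+r_L^m)(r_L^{m+1}-r_L^m)\psi_1^h(1)+(r_0^{m+1}+r_0^m)(r_0^{m+1}-r_0^m)\psi_1^h(0)\right]\\&-\frac\sigma2\left[(r_L^{m+1}+r_L^m)\psi_1^h(1)-(r_0^{m+1}+r_0^m)\psi_1^h(0)\right]=0\qquad\forall\vec\psi^h=(\psi_1^h,\psi_2^h)^\top\in\mathbb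 X^h.\end{aligned}$$ Then $$W(\vec X^{m+1})+2\pi\Delta t_m\left\langle r^m(\partial_\rho\mu^{m+1})^2,\ |\partial_\rho\vec X^m|^{-1}\right\rangle+\frac{\pi}{\eta\Delta t_m}\left[(r_L^{m+1}+r_L^m)(r_L^{m+1}-r_L^m)^2+(r_0^{m+1}+r_0^m)(r_0^{m+1}-r_0^m)^2\right]\le W(\vec X^m).$$
   Context: $\mathbb I=[0,1]$ is divided into $J$ intervals $\mathbb I_j=[q_{j-1},q_j]$, $q_j=jh$, $h=1/J$. $\mathbb K^h$ is the space of continuous functions on $\mathbb I$ that are affine on each $\mathbb I_j$, $\mathbb K^h_0$ its subspace of functions vanishing at $0$ and $1$, and $\mathbb X^h=\mathbb K^h\times\mathbb K^h_0$. $\langle\cdot,\cdot\rangle$ is the $L^2$ inner product over $\mathbb I$ with respect to $d\rho$ (scalar or vector functions). $(a,b)^\perp=(b,-a)$. For each time level $k$: $r_0^k=r^k(0)$, $r_L^k=r^k(1)$; it is assumed that $r^k>0$ on $(0,1]$ and $|\partial_\rho\vec X^k|>0$ on each element; $\theta^k$ (mod $2\pi$, constant on each element) is defined by $\partial_\rho\vec X^k/|\partial_\rho\vec X^k|=(\cos\theta^k,\sin\theta^k)^\top$. Moreover $$\vec f^{\,m+\frac12}=-\frac16\left[2r^m\partial_\rho\vec X^m+2r^{m+1}\partial_\rho\vec X^{m+1}+r^m\partial_\rho\vec X^{m+1}+r^{m+1}\partial_\rho\vec X^m\right]^\perp .$$ $\gamma=\gamma(\theta)>0$ is a $C^2$,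 even, $2\pi$-periodic surface energy density, $\mathscr S(\theta)$ a given real-valued ($2\pi$-periodic) stability function, and $$\boldsymbol{B}_1(\theta)=\begin{pmatrix}\gamma(\theta)&-\gamma'(\theta)\\ \gamma'(\theta)&\gamma(\theta)\end{pmatrix}+\mathscr S(\theta)\left[\frac12\boldsymbol I-\frac12\begin{pmatrix}\cos2\theta&\sin2\theta\\ \sin2\theta&-\cos2\theta\end{pmatrix}\right],$$ with $\boldsymbol I$ the $2\times2$ identity matrix. The energy at time level $k$ is $$W(\vec X^k)=2\pi\left\langle r^k,\ \gamma(\theta^k)|\partial_\rho\vec X^k|\right\rangle+\sigma\pi\left[(r_0^k)^2-(r_L^k)^2\right].$$ *)

(* Defs.v *)
From mathcomp Require Import all_boot all_order all_algebra.
From mathcomp Require Import all_classical all_reals all_analysis.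
Set Implicit Arguments.
Unset Strict Implicit.
Unset Printing Implicit Defensive.
Import Order.TTheory GRing.Theory Num.Theory.
Import numFieldNormedType.Exports.
Local Open Scope ring_scope.
Local Open Scope classical_set_scope.

Definition vec2 (R : realType) (a b : R) : 'cV[R]_2 :=
  \col_i (if i == 0 then a else b).

Definition mat2 (R : realType) (a b c d : R) : 'M[R]_2 :=
  \matrix_(i, j) (if i == 0 then (if j == 0 then a else b)
                  else (if j == 0 then c else d)).

Definition dot (R : realType) (u v : 'cV[R]_2) : R :=
  \sum_(i < 2) u i 0 * v i 0.

(* The library norm on matrices is the sup norm; |v| in the statement is the
   Euclidean norm. *)
Definition enorm (R : realType) (v : 'cV[R]_2) : R := Num.sqrt (dot v v).

Definition perp (R : realType) (v : 'cV[R]_2) : 'cV[R]_2 :=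
  vec2 (v 1 0) (- v 0 0).

Definition unitvec (R : realType) (t : R) : 'cV[R]_2 := vec2 (cos t) (sin t).

(* Functions on [0, 1] are represented by functions on R, whose values outside
   [0, 1] play no role.  Elements are numbered from 0:
   the element of index j : 'I_J is [node J j, node J j.+1]. *)
Definition node (R : realType) (J j : nat) : R := j%:R / J%:R.

Definition Kh (R : realType) (J : nat) : set (R -> R) :=
  [set u : R -> R | {within `[0, 1], continuous u} /\
     forall j : 'I_J, exists a b : R,
       forall x, node R J j <= x <= node R J j.+1 -> u x = a + b * x].

Definition Kh0 (R : realType) (J : nat) : set (R -> R) :=
  [set u : R -> R | Kh J u /\ u 0 = 0 /\ u 1 = 0].

Definition rcomp (R : realType) (X : R -> 'cV[R]_2) : R -> R :=
  fun x => X x 0 0.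

Definition zcomp (R : realType) (X : R -> 'cV[R]_2) : R -> R :=
  fun x => X x 1 0.

Definition Xh (R : realType) (J : nat) : set (R -> 'cV[R]_2) :=
  [set X : R -> 'cV[R]_2 | Kh J (rcomp X) /\ Kh0 J (zcomp X)].

(* Derivatives [derive1] of functions of Kh and Xh are meaningful in the
   interiors of the elements only; the nodes form a null set, so they do not
   affect the integrals. *)
Definition inner (R : realType) (u v : R -> R) : R :=
  \int[@lebesgue_measure R]_(x in `[0, 1]) (u x * v x).

Definition innerv (R : realType) (u v : R -> 'cV[R]_2) : R :=
  \int[@lebesgue_measure R]_(x in `[0, 1]) dot (u x) (v x).

Definition speed (R : realType) (X : R -> 'cV[R]_2) : R -> R :=
  fun x => enorm (derive1 X x).

Definition regular_curve (R : realType) (J : nat) (X : R -> 'cV[R]_2) : Prop :=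
  (forall x : R, 0 < x <= 1 -> 0 < rcomp X x) /\
  (forall (j : 'I_J) (x : R),
     node R J j < x < node R J j.+1 -> 0 < speed X x).

(* The angle is determined only modulo 2 pi, so it is a predicate: any choice
   of representative on each element is allowed. *)
Definition tangent_angle (R : realType) (J : nat) (X : R -> 'cV[R]_2)
    (theta : R -> R) : Prop :=
  forall j : 'I_J, exists t : R,
    forall x, node R J j < x < node R J j.+1 ->
      theta x = t /\ (speed X x)^-1 *: derive1 X x = unitvec t.

(* X is the curve at level m, Y the curve at level m + 1. *)
Definition fhalf (R : realType) (X Y : R -> 'cV[R]_2) : R -> 'cV[R]_2 :=
  fun x => - 6^-1 *:
    perp ((2 * rcomp X x) *: derive1 X x + (2 * rcomp Y x) *: derive1 Y x
          + rcomp X x *: derive1 Y x + rcomp Y x *: derive1 X x).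

Definition B1 (R : realType) (gamma S : R -> R) (t : R) : 'M[R]_2 :=
  mat2 (gamma t) (- derive1 gamma t) (derive1 gamma t) (gamma t)
  + S t *: (2^-1 *: 1%:M
            - 2^-1 *: mat2 (cos (2 * t)) (sin (2 * t))
                              (sin (2 * t)) (- cos (2 * t))).

Definition C2 (R : realType) (g : R -> R) : Prop :=
  (forall x, derivable g x 1) /\ (forall x, derivable (derive1 g) x 1) /\
  continuous (derive1 (derive1 g)).

Definition energy (R : realType) (gamma : R -> R) (sigma : R)
    (X : R -> 'cV[R]_2) (theta : R -> R) : R :=
  2 * pi * inner (rcomp X) (fun x => gamma (theta x) * speed X x)
  + sigma * pi * (rcomp X 0 ^+ 2 - rcomp X 1 ^+ 2).

(* Main.v *)
Require Import Defs.
From mathcomp Require Import all_boot all_order all_algebra.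
From mathcomp Require Import all_classical all_reals all_analysis.
From mathcomp Require Import measurable_realfun.
From mathcomp Require Import ring lra.
Import Order.TTheory GRing.Theory Num.Theory.
Import numFieldNormedType.Exports.
Local Open Scope ring_scope.

(** The energy decay follows from testing the scheme with its own solution.

    Testing [scheme1] with [mu] and [scheme2] with the increment [Xm1 - Xm]
    makes the two coupling terms [<mu f, Xm1 - Xm>] equal, so they can be
    eliminated: the first equation turns them into
    [dt <r^m mu'^2, 1/|Xm'|>], the dissipation.  The boundary terms multiply
    [r^{m+1} - r^m] at the two endpoints, which produces the contact-line
    dissipation and, by [(a + b)(a - b) = a^2 - b^2], the telescoping substrate
    energy.

    What is left is to bound the two surface-energy terms of [scheme2]
    from below by the increment of [<r, gamma |X'|>].  This is
    pointwise ([energy_increment_le]): multiplying the assumed inequality on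
    [B1], with [v = Xm'] and [w = Xm1'], by [r^m > 0] gives
    [r^m (|w| gamma_1 - |v| gamma_0)], and adding
    [(r^{m+1} - r^m) gamma_1 |w|] gives exactly
    [r^{m+1} gamma_1 |w| - r^m gamma_0 |v|], where [gamma_0] and [gamma_1] are
    the densities at the old and the new angle.

    Two points need care.  The inequality on [B1] is assumed for angles in
    [-pi, pi] only, whereas the tangent angles are arbitrary representatives;
    since everything is periodic, one may pass to the principal value
    ([periodic_principal_value], [anisotropy_inequality]).  And derivatives and
    angles are controlled in the interiors of the elements only, so that
    integrability and monotonicity of the integrals are proved for functions
    that are affine on each open element and arbitrary at the nodes
    ([integrable_affine_on_elements], [le_Rintegral_elements]). *)

Section PiecewiseAffineCurves.
Local Open Scope classical_set_scope.
Set Implicit Arguments.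
Unset Strict Implicit.

(** * Tangent angles modulo 2 pi *)

(** The same [t0] serves all periodic functions at once, whatever their
    codomain: below it is used for scalars, vectors and matrices. *)
Lemma periodic_principal_value (R : realType) (t : R) :
  exists2 t0 : R, - pi <= t0 <= pi &
    forall (V : zmodType) (f : R -> V), periodic f (pi *+ 2) -> f t = f t0.
Proof.
have pi2_gt0 : 0 < pi *+ 2 :> R by rewrite mulrn_wgt0// pi_gt0.
set n := Num.floor ((t + pi) / (pi *+ 2)).
have /andP[nle nlt] := floor_itv ((t + pi) / (pi *+ 2)).
rewrite -/n ler_pdivlMr // in nle; rewrite -/n ltr_pdivrMr // intrD in nlt.
exists (t - pi *+ 2 *~ n).
  rewrite -mulrzl; apply/andP; split; lra.
move=> V f fper; case: n {nle nlt} => n.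
  by rewrite -[in LHS](subrK (pi *+ 2 *~ Posz n) t) -pmulrn periodicn.
by rewrite NegzE mulrNz opprK -pmulrn periodicn.
Qed.

Lemma derive1_periodic (R : realType) (f : R -> R) (T : R) :
  periodic f T -> periodic (derive1 f) T.
Proof.
move=> fT u; by rewrite /derive1; under eq_fun do rewrite addrA !fT.
Qed.

Lemma unitvec_periodic (R : realType) : periodic (@unitvec R) (pi *+ 2).
Proof. by move=> t; rewrite /unitvec cosD2pi sinD2pi. Qed.

Lemma B1_periodic (R : realType) (gamma S : R -> R) :
  periodic gamma (pi *+ 2) -> periodic S (pi *+ 2) ->
  periodic (B1 gamma S) (pi *+ 2).
Proof.
move=> gP sP t; rewrite /B1 gP sP derive1_periodic //.
have -> : 2 * (t + pi *+ 2) = 2 * t + pi *+ 2 *+ 2.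
  by rewrite mulrDr [2 * (pi *+ 2)]mulr_natl.
by rewrite !periodicn //; [exact: sinD2pi | exact: cosD2pi].
Qed.

Lemma enorm0 (R : realType) : enorm (0 : 'cV[R]_2) = 0.
Proof. by rewrite /enorm /dot !big_ord_recl big_ord0 !mxE !mulr0 !addr0 sqrtr0. Qed.

(** The hypothesis on [B1], freed from the restriction on the angles and put in
    the form in which tangent angles are given. *)
Lemma anisotropy_inequality (R : realType) (gamma S : R -> R)
  (gamma_per : periodic gamma (pi *+ 2)) (S_per : periodic S (pi *+ 2))
  (B1_ineq : forall (v w : 'cV[R]_2) (t t' : R),
     v != 0 -> w != 0 ->
     - pi <= t <= pi -> - pi <= t' <= pi ->
     v = enorm v *: unitvec t -> w = enorm w *: unitvec t' ->
     enorm w * gamma t' - enorm v * gamma t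
       <= (enorm v)^-1 * dot (B1 gamma S t *m w) (w - v))
  (v w : 'cV[R]_2) (t t' : R) :
  0 < enorm v -> 0 < enorm w ->
  (enorm v)^-1 *: v = unitvec t -> (enorm w)^-1 *: w = unitvec t' ->
  enorm w * gamma t' - enorm v * gamma t
    <= (enorm v)^-1 * dot (B1 gamma S t *m w) (w - v).
Proof.
move=> v0 w0 vt wt.
have [t0 t0I tt0] := periodic_principal_value t.
have [t1 t1I tt1] := periodic_principal_value t'.
rewrite (tt0 _ _ gamma_per) (tt1 _ _ gamma_per).
rewrite (tt0 _ _ (B1_periodic gamma_per S_per)).
apply: B1_ineq => //.
- by apply: contraTneq v0 => ->; rewrite enorm0 ltxx.
- by apply: contraTneq w0 => ->; rewrite enorm0 ltxx.
- by rewrite -(tt0 _ _ (@unitvec_periodic R)) -vt scalerA mulfV ?scale1r ?gt_eqF.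
- by rewrite -(tt1 _ _ (@unitvec_periodic R)) -wt scalerA mulfV ?scale1r ?gt_eqF.
Qed.

(** * Finite element functions on one element *)

Lemma Kh_sub (R : realType) (J : nat) (u v : R -> R) :
  Kh J u -> Kh J v -> Kh J (u \- v).
Proof.
move=> [uc ua] [vc va]; split.
  by move=> x; apply: cvgB; [exact: uc | exact: vc].
move=> j; have [a [b ab]] := ua j; have [c [d cd]] := va j.
by exists (a - c), (b - d) => x xj; rewrite /= ab // cd //; ring.
Qed.

Lemma Xh_sub (R : realType) (J : nat) (X Y : R -> 'cV[R]_2) :
  Xh J X -> Xh J Y -> Xh J (X \- Y).
Proof.
move=> [Xr [Xz [X0 X1]]] [Yr [Yz [Y0 Y1]]].
have rE : rcomp (X \- Y) = rcomp X \- rcomp Y.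
  by apply/funext => x; rewrite /rcomp /= !mxE.
have zE : zcomp (X \- Y) = zcomp X \- zcomp Y.
  by apply/funext => x; rewrite /zcomp /= !mxE.
split; first by rewrite rE; exact: Kh_sub.
by rewrite zE; split; [exact: Kh_sub | rewrite /= X0 X1 Y0 Y1 !subrr].
Qed.

Lemma derive1_affine (R : realType) (V : normedModType R) (A B : V) (x : R) :
  derive1 (fun y : R => A + y *: B) x = B.
Proof.
rewrite /derive1; apply/cvg_lim => //.
apply: cvg_near_cst; near=> h.
have h0 : h != 0 by near: h; exact: nbhs_dnbhs_neq.
by rewrite opprD addrACA subrr add0r -scalerBl addrK scalerA mulVf ?scale1r.
Unshelve. all: by end_near. Qed.

Lemma derive1_locally_affine (R : realType) (V : normedModType R)
  (f : R -> V) (A B : V) (a b x : R) :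
  (forall y, a < y < b -> f y = A + y *: B) -> a < x < b -> derive1 f x = B.
Proof.
move=> fE xab; rewrite -(derive1_affine A B x) !derive1E.
apply: near_eq_derive.
have : x \in `]a, b[%R by rewrite in_itv.
by move=> /near_in_itvoo; apply: filterS => y /=; rewrite in_itv /=; exact: fE.
Qed.

(** On open elements, the derivative is the slope; at a node the two one-sided
    slopes differ, which is why the nodes are left out. *)
Lemma Xh_affine (R : realType) (J : nat) (X : R -> 'cV[R]_2) (j : 'I_J) :
  Xh J X -> exists A B : 'cV[R]_2,
    forall x, node R J j < x < node R J j.+1 ->
      X x = A + x *: B /\ derive1 X x = B.
Proof.
move=> [[_ /(_ j) [a [b ab]]] [[_ /(_ j) [c [d cd]]] _]].
pose A := vec2 a c; pose B := vec2 b d.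
have XE x : node R J j < x < node R J j.+1 -> X x = A + x *: B.
  move=> /andP[x1 x2]; apply/matrixP => i k; rewrite !mxE (ord1 k).
  have xj : node R J j <= x <= node R J j.+1 by rewrite !ltW.
  case: (unliftP ord0 i) => [i'|] -> /=.
    rewrite (ord1 i') (_ : lift ord0 0 = 1); last exact: val_inj.
    by have := cd _ xj; rewrite /zcomp mulrC.
  by have := ab _ xj; rewrite /rcomp mulrC.
exists A, B => x xj; split; first exact: XE.
exact: (derive1_locally_affine XE xj).
Qed.

(** * Integration of element-wise affine functions *)

(** No condition at the nodes, not even continuity: the integrands of the scheme
    contain derivatives and angles, which are unspecified there. *)
Definition affine_on_elements (R : realType) (J : nat) (f : R -> R) : Prop :=
  forall j : 'I_J, exists a b : R,
    forall x, node R J j < x < node R J j.+1 -> f x = a + b * x.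

Definition nodes (R : realType) (J : nat) : set R :=
  [set x | exists2 k, (k <= J)%N & x = node R J k].
Arguments nodes : clear implicits.

Lemma node0 (R : realType) (J : nat) : node R J 0 = 0.
Proof. by rewrite /node mul0r. Qed.

Lemma nodeJ (R : realType) (J : nat) : (0 < J)%N -> node R J J = 1.
Proof. by move=> J0; rewrite /node divff // pnatr_eq0 -lt0n. Qed.

Lemma node_lt (R : realType) (J k : nat) :
  (0 < J)%N -> node R J k < node R J k.+1.
Proof. by move=> J0; rewrite /node ltr_pM2r ?invr_gt0 ?ltr0n // ltr_nat. Qed.

Lemma elements_cover (R : realType) (J : nat) (x : R) : (0 < J)%N ->
  0 <= x <= 1 -> ~ nodes R J x ->
  exists j : 'I_J, node R J j < x < node R J j.+1.
Proof.
move=> J0 /andP[x0 x1] xN.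
suff H : forall k, (k <= J)%N -> x <= node R J k ->
    exists j : 'I_J, node R J j < x < node R J j.+1.
  by apply: (H J) => //; rewrite nodeJ.
elim=> [_|k IH kJ xk].
  rewrite node0 => x0'; exfalso; apply: xN; exists 0%N => //.
  by rewrite node0; apply/le_anti; rewrite x0 x0'.
have [xk'|kx] := leP x (node R J k); first exact: IH (ltnW kJ) xk'.
exists (Ordinal kJ) => /=; rewrite kx lt_neqAle xk andbT.
by apply/eqP => xE; apply: xN; exists k.+1.
Qed.

Lemma nodes_null (R : realType) (J : nat) :
  measurable (nodes R J) /\ lebesgue_measure (nodes R J) = 0%E.
Proof.
have cN : countable (nodes R J).
  apply: sub_countable (countableP [set: nat]).
  apply: card_le_trans (card_image_le (node R J) _).
  by apply: subset_card_le => _ [k _ ->]; exists k.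
split; last exact: countable_lebesgue_measure0.
exact: countable_measurable.
Qed.

Lemma integrable_setU_disjoint d (T : measurableType d) (R : realType)
  (mu : {measure set T -> \bar R}) (A B : set T) (f : T -> \bar R) :
  measurable A -> measurable B -> [disjoint A & B] ->
  mu.-integrable A f -> mu.-integrable B f -> mu.-integrable (A `|` B) f.
Proof.
move=> mA mB AB /integrableP[mfA ifA] /integrableP[mfB ifB].
have mf := (measurable_funU _ mA mB).2 (conj mfA mfB).
apply/integrableP; split => //.
rewrite ge0_integral_setU //; first exact: lte_add_pinfty.
exact: measurableT_comp.
Qed.

(** Induction on the number of elements: each step adds an open element, where
    the function agrees with a continuous one, and then a single point. *)
Lemma integrable_affine_on_elements (R : realType) (J : nat) (f : R -> R) :
  (0 < J)%N -> affine_on_elements J f ->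
  (@lebesgue_measure R).-integrable `[0, 1] (EFin \o f).
Proof.
move=> J0 fJ.
have sing (a : R) : (@lebesgue_measure R).-integrable [set a] (EFin \o f).
  apply: continuous_compact_integrable; first exact: compact_set1.
  exact: continuous_subspace1.
suff H : forall k, (k <= J)%N ->
    (@lebesgue_measure R).-integrable `[0, node R J k] (EFin \o f).
  by rewrite -(nodeJ R J0); exact: H.
elim=> [_|k IH kJ]; first by rewrite node0 set_itv1.
have klt := node_lt R k J0.
have k0 : 0 <= node R J k by rewrite divr_ge0 ?ler0n.
have inter : (@lebesgue_measure R).-integrable
    `]node R J k, node R J k.+1[ (EFin \o f).
  have [a [b fE]] := fJ (Ordinal kJ).
  pose g (x : R) := a + b * x.
  suff : (@lebesgue_measure R).-integrable
      `]node R J k, node R J k.+1[ (EFin \o g).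
    apply: eq_integrable; first exact: measurable_itv.
    by move=> x; rewrite inE /= in_itv /= => xk; rewrite fE.
  have : (@lebesgue_measure R).-integrable
      `[node R J k, node R J k.+1] (EFin \o g).
    apply: continuous_compact_integrable; first exact: segment_compact.
    apply: continuous_subspaceT => x; apply: cvgD; first exact: cvg_cst.
    by apply: cvgM; [exact: cvg_cst | exact: cvg_id].
  by apply: integrableS => //; exact: subset_itv_oo_cc.
rewrite -(@setUitv1 _ _ _ _ true) ?bnd_simp; last exact: le_trans (ltW klt).
rewrite (@itv_bndbnd_setU _ _ _ (BRight (node R J k))) ?bnd_simp //.
apply: integrable_setU_disjoint => //.
- exact: measurableU.
- apply/disj_set2P; rewrite -subset0 => x [+ /= xE].
  rewrite xE => -[|] /=; rewrite in_itv /=.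
    by rewrite [_ <= node R J k]leNgt klt andbF.
  by rewrite ltxx andbF.
apply: integrable_setU_disjoint => //.
- apply/disj_set2P; rewrite -subset0 => x [] /=.
  by rewrite !in_itv /= => /andP[_ xk] /andP[]; rewrite ltNge xk.
- exact: IH (ltnW kJ).
Qed.

(** The nodes form a null set, so both integrals can be restricted to the open
    elements. *)
Lemma le_Rintegral_elements (R : realType) (J : nat) (f g : R -> R) :
  (0 < J)%N -> affine_on_elements J f -> affine_on_elements J g ->
  (forall (j : 'I_J) x, node R J j < x < node R J j.+1 -> f x <= g x) ->
  \int[@lebesgue_measure R]_(x in `[0, 1]) f x
    <= \int[@lebesgue_measure R]_(x in `[0, 1]) g x.
Proof.
move=> J0 fJ gJ fg; have [mN N0] := nodes_null R J.
have mDN : measurable (`[0, 1] `\` nodes R J) by apply: measurableD.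
have off_nodes h : affine_on_elements J h ->
    (@lebesgue_measure R).-integrable (`[0, 1] `\` nodes R J) (EFin \o h) /\
    \int[@lebesgue_measure R]_(x in `[0, 1]) h x =
    \int[@lebesgue_measure R]_(x in `[0, 1] `\` nodes R J) h x.
  move=> hJ; have hi := integrable_affine_on_elements J0 hJ.
  split; first by apply: integrableS hi => //; exact: subDsetl.
  by rewrite /Rintegral; congr fine; apply: negligible_integral.
have [fi ->] := off_nodes _ fJ; have [gi ->] := off_nodes _ gJ.
apply: le_Rintegral => //.
move=> x [/=]; rewrite in_itv /= => x01 xN.
by have [j xj] := elements_cover J0 x01 xN; exact: fg xj.
Qed.

Lemma affine_on_elementsD (R : realType) (J : nat) (f g : R -> R) :
  affine_on_elements J f -> affine_on_elements J g ->
  affine_on_elements J (fun x => f x + g x).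
Proof.
move=> fJ gJ j; have [a [b fE]] := fJ j; have [c [d gE]] := gJ j.
by exists (a + c), (b + d) => x xj; rewrite fE // gE //; ring.
Qed.

Lemma dotZ (R : realType) (a b : R) (u v : 'cV[R]_2) :
  dot (a *: u) (b *: v) = a * (b * dot u v).
Proof.
rewrite /dot !mulr_sumr; apply: eq_bigr => i _; rewrite !mxE; ring.
Qed.

Lemma element_in_unit (R : realType) (J : nat) (j : 'I_J) (x : R) :
  (0 < J)%N -> node R J j < x < node R J j.+1 -> 0 < x <= 1.
Proof.
move=> J0 /andP[jx xj]; apply/andP; split.
  by apply: le_lt_trans jx; rewrite divr_ge0.
apply: le_trans (ltW xj) _.
by rewrite /node ler_pdivrMr ?ltr0n // mul1r ler_nat.
Qed.

(** * The energy increment *)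

(** The convexity-type bound at the core of the stability: the surface-energy
    terms of the discrete equation, tested with [Y - X], dominate the increment
    of the surface energy from [X] to [Y]. *)
Lemma energy_increment_le (R : realType) (J : nat) (gamma S : R -> R)
  (X Y : R -> 'cV[R]_2) (theta theta' : R -> R) :
  (0 < J)%N ->
  (forall (v w : 'cV[R]_2) (t t' : R), 0 < enorm v -> 0 < enorm w ->
     (enorm v)^-1 *: v = unitvec t -> (enorm w)^-1 *: w = unitvec t' ->
     enorm w * gamma t' - enorm v * gamma t
       <= (enorm v)^-1 * dot (B1 gamma S t *m w) (w - v)) ->
  Xh J X -> Xh J Y -> regular_curve J X -> regular_curve J Y ->
  tangent_angle J X theta -> tangent_angle J Y theta' ->
  inner (rcomp Y) (fun x => gamma (theta' x) * speed Y x) <=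
  inner (rcomp X) (fun x => gamma (theta x) * speed X x)
  + inner (fun x => gamma (theta' x)) (fun x => rcomp (Y \- X) x * speed Y x)
  + innerv (fun x => rcomp X x *: (B1 gamma S (theta x) *m derive1 Y x))
           (fun x => (speed X x)^-1 *: derive1 (Y \- X) x).
Proof.
move=> J0 gap XJ YJ [X_pos X_speed] [Y_pos Y_speed] Xt Yt.
pose DY x := rcomp Y x * (gamma (theta' x) * speed Y x).
pose DX x := rcomp X x * (gamma (theta x) * speed X x).
pose F x := gamma (theta' x) * (rcomp (Y \- X) x * speed Y x).
pose G x := dot (rcomp X x *: (B1 gamma S (theta x) *m derive1 Y x))
                ((speed X x)^-1 *: derive1 (Y \- X) x).
(* On an element all four integrands are a radius, or a difference of radii,
   hence affine in x, times a constant built from the slopes B, B' and the angles t, t'. *)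
have data (j : 'I_J) : exists A B A' B' : 'cV[R]_2, exists t t' : R,
    forall x, node R J j < x < node R J j.+1 ->
    [/\ DY x = (A' 0 0 + x * B' 0 0) * (gamma t' * enorm B'),
        DX x = (A 0 0 + x * B 0 0) * (gamma t * enorm B),
        F x = gamma t' * (((A' 0 0 + x * B' 0 0) - (A 0 0 + x * B 0 0)) * enorm B'),
        G x = (A 0 0 + x * B 0 0) * ((enorm B)^-1 * dot (B1 gamma S t *m B') (B' - B))
      & [/\ 0 < A 0 0 + x * B 0 0, 0 < enorm B, 0 < enorm B',
           (enorm B)^-1 *: B = unitvec t & (enorm B')^-1 *: B' = unitvec t']].
  have [A [B XE]] := Xh_affine j XJ.
  have [A' [B' YE]] := Xh_affine j YJ.
  have [t tE] := Xt j; have [t' t'E] := Yt j.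
  exists A, B, A', B', t, t' => x xj.
  have [Xx X'x] := XE x xj; have [Yx Y'x] := YE x xj.
  have [tx Bt] := tE x xj; have [t'x B't'] := t'E x xj.
  have dE : derive1 (Y \- X) x = B' - B.
    apply: (derive1_locally_affine (A := A' - A) _ xj) => y yj /=.
    have [-> _] := XE y yj; have [-> _] := YE y yj.
    by rewrite scalerBr opprD addrACA.
  have sX : speed X x = enorm B by rewrite /speed X'x.
  have sY : speed Y x = enorm B' by rewrite /speed Y'x.
  have rX : rcomp X x = A 0 0 + x * B 0 0 by rewrite /rcomp Xx !mxE.
  have rY : rcomp Y x = A' 0 0 + x * B' 0 0 by rewrite /rcomp Yx !mxE.
  have rYX : rcomp (Y \- X) x = rcomp Y x - rcomp X x by rewrite /rcomp !mxE.
  rewrite /DY /DX /F /G rYX rX rY sX sY tx t'x dE Y'x dotZ; split=> //.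
  split.
  - by rewrite -rX; apply: X_pos; exact: (element_in_unit J0 xj).
  - by rewrite -sX; exact: X_speed xj.
  - by rewrite -sY; exact: Y_speed xj.
  - by rewrite -Bt sX X'x.
  - by rewrite -B't' sY Y'x.
have DYJ : affine_on_elements J DY.
  move=> j; have [A [B [A' [B' [t [t' H]]]]]] := data j.
  exists (A' 0 0 * (gamma t' * enorm B')), (B' 0 0 * (gamma t' * enorm B')).
  by move=> x /H[-> _ _ _ _]; ring.
have DXJ : affine_on_elements J DX.
  move=> j; have [A [B [A' [B' [t [t' H]]]]]] := data j.
  exists (A 0 0 * (gamma t * enorm B)), (B 0 0 * (gamma t * enorm B)).
  by move=> x /H[_ -> _ _ _]; ring.
have FJ : affine_on_elements J F.
  move=> j; have [A [B [A' [B' [t [t' H]]]]]] := data j.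
  exists (gamma t' * ((A' 0 0 - A 0 0) * enorm B')),
         (gamma t' * ((B' 0 0 - B 0 0) * enorm B')).
  by move=> x /H[_ _ -> _ _]; ring.
have GJ : affine_on_elements J G.
  move=> j; have [A [B [A' [B' [t [t' H]]]]]] := data j.
  pose c := (enorm B)^-1 * dot (B1 gamma S t *m B') (B' - B).
  exists (A 0 0 * c), (B 0 0 * c).
  by move=> x /H[_ _ _ -> _]; rewrite -/c; ring.
have integrable h : affine_on_elements J h -> _ :=
  integrable_affine_on_elements J0.
have DXFJ := affine_on_elementsD DXJ FJ.
rewrite /inner /innerv -/DX -/F -/G.
rewrite -RintegralD //; [|exact: integrable..].
rewrite -RintegralD //; [|exact: integrable..].
apply: (le_Rintegral_elements (J := J) (f := DY)
  (g := fun x => DX x + F x + G x)) => //.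
  exact: affine_on_elementsD.
move=> j x xj; have [A [B [A' [B' [t [t' H]]]]]] := data j.
have [-> -> -> -> [r0 B0 B'0 Bt B't']] := H x xj.
(* After multiplication by the old radius the claim is linear in the
   products that occur. *)
have := ler_wpM2l (ltW r0) (gap _ _ _ _ B0 B'0 Bt B't').
lra.
Qed.

End PiecewiseAffineCurves.

Theorem theorem4p3 (R : realType) (J : nat) (J_gt0 : (0 < J)%N)
  (gamma S : R -> R)
  (gamma_gt0 : forall t, 0 < gamma t)
  (gamma_C2 : C2 gamma)
  (gamma_even : forall t, gamma (- t) = gamma t)
  (gamma_per : periodic gamma (pi *+ 2))
  (S_per : periodic S (pi *+ 2))
  (B1_ineq : forall (v w : 'cV[R]_2) (t t' : R),
     v != 0 -> w != 0 ->
     - pi <= t <= pi -> - pi <= t' <= pi ->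
     v = enorm v *: unitvec t -> w = enorm w *: unitvec t' ->
     enorm w * gamma t' - enorm v * gamma t
       <= (enorm v)^-1 * dot (B1 gamma S t *m w) (w - v))
  (eta sigma dt : R) (eta_gt0 : 0 < eta) (dt_gt0 : 0 < dt)
  (Xm Xm1 : R -> 'cV[R]_2) (mu : R -> R) (thetam thetam1 : R -> R)
  (Xm_Xh : Xh J Xm) (Xm1_Xh : Xh J Xm1) (mu_Kh : Kh J mu)
  (Xm_nondeg : regular_curve J Xm) (Xm1_nondeg : regular_curve J Xm1)
  (thetam_angle : tangent_angle J Xm thetam)
  (thetam1_angle : tangent_angle J Xm1 thetam1)
  (scheme1 : forall phi : R -> R, Kh J phi ->
     dt^-1 * innerv (fun x => Xm1 x - Xm x) (fun x => phi x *: fhalf Xm Xm1 x)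
     - inner (fun x => rcomp Xm x * derive1 mu x)
             (fun x => derive1 phi x * (speed Xm x)^-1) = 0)
  (scheme2 : forall psi : R -> 'cV[R]_2, Xh J psi ->
     innerv (fun x => mu x *: fhalf Xm Xm1 x) psi
     + inner (fun x => gamma (thetam1 x)) (fun x => rcomp psi x * speed Xm1 x)
     + innerv (fun x => rcomp Xm x *: (B1 gamma S (thetam x) *m derive1 Xm1 x))
              (fun x => (speed Xm x)^-1 *: derive1 psi x)
     + (2 * eta * dt)^-1 *
       ((rcomp Xm1 1 + rcomp Xm 1) * (rcomp Xm1 1 - rcomp Xm 1) * rcomp psi 1
        + (rcomp Xm1 0 + rcomp Xm 0) * (rcomp Xm1 0 - rcomp Xm 0) * rcomp psi 0)
     - sigma / 2 *
       ((rcomp Xm1 1 + rcomp Xm 1) * rcomp psi 1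
        - (rcomp Xm1 0 + rcomp Xm 0) * rcomp psi 0) = 0) :
  energy gamma sigma Xm1 thetam1
  + 2 * pi * dt *
    inner (fun x => rcomp Xm x * derive1 mu x ^+ 2) (fun x => (speed Xm x)^-1)
  + pi / (eta * dt) *
    ((rcomp Xm1 1 + rcomp Xm 1) * (rcomp Xm1 1 - rcomp Xm 1) ^+ 2
     + (rcomp Xm1 0 + rcomp Xm 0) * (rcomp Xm1 0 - rcomp Xm 0) ^+ 2)
  <= energy gamma sigma Xm thetam.
Proof.
have psi_Xh : Xh J (Xm1 \- Xm) by exact: Xh_sub.
have := scheme1 mu mu_Kh; have := scheme2 (Xm1 \- Xm) psi_Xh.
have := energy_increment_le (S := S) J_gt0
  (anisotropy_inequality gamma_per S_per B1_ineq)
  Xm_Xh Xm1_Xh Xm_nondeg Xm1_nondeg thetam_angle thetam1_angle.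
rewrite /energy.
set IY := inner (rcomp Xm1) _; set IX := inner (rcomp Xm) _.
set P := inner _ (fun x => _ * _); set Q := innerv (fun x => rcomp Xm x *: _) _.
set M := innerv _ (Xm1 \- Xm).
set N := innerv (fun x => Xm1 x - Xm x) _.
set D := inner _ (fun x => derive1 mu x * _).
set D' := inner (fun x => _ * derive1 mu x ^+ 2) _.
(* The two coupling terms are the same integral with the factors permuted. *)
have -> : N = M.
  apply: eq_Rintegral => x _; rewrite /dot; apply: eq_bigr => i _.
  by rewrite !mxE; ring.
have -> : D = D'.
  by apply: eq_Rintegral => x _; rewrite expr2 !mulrA.
have rE y : rcomp (Xm1 \- Xm) y = rcomp Xm1 y - rcomp Xm y.
  by rewrite /rcomp !mxE.
rewrite !rE => incr test_increment test_mu.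
have pi0 := pi_gt0 R.
have ME : M = dt * D'.
  have /eqP := test_mu; rewrite subr_eq0 => /eqP <-.
  by rewrite mulrA mulfV ?mul1r ?gt_eqF.
rewrite ME in test_increment.
have scaled := congr1 ( *%R (2 * pi)) test_increment.
have -> : pi / (eta * dt) = 2 * pi * (2 * eta * dt)^-1.
  by field; rewrite !gt_eqF.
have : 2 * pi * IY <= 2 * pi * (IX + P + Q) by rewrite ler_pM2l // mulr_gt0.
lra.
Qed.
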